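(* Let $X$ be the diffusion process on $E\cup\partial$ described in the context, with quasi-stationary distribution $\alpha$, absorption rate $\lambda_0$, eigenfunction $\eta$, and constants $C,\gamma>0$ as specified there. Then, for all $t\ge0$ and $x\in E$, $$\eta(x)\le e^{\lambda_0t}+Ce^{-\gamma t},$$ and, for all measurable $A\subset E$ such that $\alpha(A)>0$ and all $t\ge 0$, $$\frac{1}{\alpha(A)}\int_A\eta(x)\,d\alpha(x)\ge e^{\lambda_0t}+Ce^{-\gamma t}-\frac{e^{\lambda_0t}-1+Ce^{-\gamma t}}{\alpha(A)}.$$ In addition, for all measurable $B\subset E$ such that $\alpha(B)>0$, let $\alpha_{|B}$ be the probability measure $\alpha_{|B}(dx)=\frac{\mathbf{1}_{x\in B}\,d\alpha(x)}{\alpha(B)}$. Then, for all such $B$, all $t\ge0$ and all measurable $A\subset E$, $$\left|\mathbb{P}_{\alpha_{|B}}(X_t\in A)-\alpha(A)\right|\le\frac{\alpha(A)}{\alpha(B)}\left(1-e^{-\lambda_0t}+Ce^{-(\lambda_0+\gamma)t}\right)+Ce^{-(\lambda_0+\gamma)t}\left(\|\eta\|_\infty+2\alpha(A)+Ce^{-\gamma t}\right).$$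
   Context: Let $d,r\ge1$, let $v_1,\ldots,v_r\in(\mathbb{R}_+)^d\setminus\{0\}$, and let $E=\{x\in[0,+\infty)^d:\langle x,v_j\rangle<1\ \forall j=1,\ldots,r\}$, assumed bounded, and $\partial=\{x\in[0,+\infty)^d:\langle x,v_j\rangle\le1\ \forall j,\ \langle x,v_j\rangle=1\text{ for some }j\}$. $X$ is the diffusion process in $E\cup\partial$ with the hyperplanes $x_i=0$ as normal reflecting boundaries and the hyperplanes $\langle x,v_j\rangle=1$ as absorbing boundaries, whose infinitesimal generator is, for all smooth $f$ vanishing on the hyperplanes $\langle x,v_j\rangle=1$ and with zero normal gradient on the hyperplanes $x_i=0$, $Lf=\sum_{i,k=1}^d a_{ik}\frac{\partial^2f}{\partial x_i\partial x_k}+\sum_{i=1}^d b_i\frac{\partial f}{\partial x_i}$, where $a$ is symmetric and uniformly elliptic, $b$ is uniformly bounded, and both are H\''older continuous on $E\cup\partial$. The absorption time is $\tau_\partial=\inf\{t\ge0:X_t\in\partial\}$, and $X_t\in\partial$ for $t\ge\tau_\partial$. $\mathbb{P}_\mu$ is the law of the process with initial distribution $\mu$, and $\mathbb{P}_x=\mathbb{P}_{\delta_x}$. The following facts may be taken as given. $X$ has a unique quasi-stationary distribution $\alpha$, i.e. a probability measure on $E$ with $\mathbb{P}_\alpha(X_t\in\cdot\mid t<\tau_\partial)=\alpha$ for all $t\ge0$. There is $\lambda_0>0$ with $\mathbb{P}_\alpha(t<\tau_\partial)=e^{-\lambda_0t}$ for all $t\ge0$. The function $\eta(x)=\lim_{t\to+\infty}e^{\lambda_0t}\mathbb{P}_x(t<\tau_\partial)$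 is well defined, positive and bounded on $E$, is an eigenfunction of $L$ for the eigenvalue $-\lambda_0$ with Dirichlet condition at the absorbing boundary, and satisfies $\int_E\eta\,d\alpha=1$. The constants $C,\gamma>0$ are such that, for all $t\ge0$, all probability measures $\mu$ on $E$ and all $x\in E$, $$\left\|\mathbb{P}_\mu(X_t\in\cdot\mid t<\tau_\partial)-\alpha\right\|_{TV}\le Ce^{-\gamma t}\quad\text{and}\quad|e^{\lambda_0t}\mathbb{P}_x(t<\tau_\partial)-\eta(x)|\le Ce^{-\gamma t}.$$ $\|\cdot\|_{TV}$ is the total variation norm, and $\|\eta\|_\infty=\sup_{x\in E}\eta(x)$. *)

(* Defs.v *)
From HB Require Import structures.
From mathcomp Require Import all_boot all_order all_algebra.
From mathcomp Require Import all_classical all_reals all_analysis.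

Set Implicit Arguments.
Unset Strict Implicit.
Unset Printing Implicit Defensive.

Import Order.TTheory GRing.Theory Num.Theory.
Import numFieldNormedType.Exports.

Local Open Scope classical_set_scope.
Local Open Scope ring_scope.

(* Matrices, hence vectors, carry their Borel sigma-algebra. *)
HB.instance Definition _ (R : realType) (m n : nat) :=
  Measurable.copy 'M[R]_(m, n) (g_sigma_algebraType (@open 'M[R]_(m, n))).

(* Total mass |nu|(T) of a signed measure nu, as the supremum over finite
   disjoint measurable families; for a difference of two probabilities this is
   twice sup_A |nu A|. *)
Definition tv_norm d (T : measurableType d) (R : realType) (nu : set T -> R)
    : \bar R :=
  ereal_sup [set (\sum_(i < nF.1) `|nu (nF.2 i)|)%:E
    | nF in [set nF : nat * (nat -> set T) |
        (forall i, measurable (nF.2 i)) /\ trivIset setT nF.2]].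

Section Domain.
Variables (R : realType) (d r : nat).
Local Notation V := 'rV[R]_d.

Definition inner (x y : V) : R := \sum_(i < d) x 0 i * y 0 i.

Definition dom (v : 'I_r -> V) : set V :=
  [set x : V | (forall i, 0 <= x 0 i) /\ (forall j, inner x (v j) < 1)].

Definition absorb (v : 'I_r -> V) : set V :=
  [set x : V | [/\ forall i, 0 <= x 0 i, forall j, inner x (v j) <= 1
             & exists j, inner x (v j) = 1]].
End Domain.

Section Operator.
Variables (R : realType) (d : nat).
Local Notation V := 'rV[R]_d.

Definition partial (i : 'I_d) (f : V -> R) : V -> R :=
  fun x => 'D_(delta_mx 0 i) f x.

(* infinitely differentiable on the whole space: every iterated partial
   derivative exists and is continuous *)
Definition smooth (f : V -> R) : Prop :=
  forall s : seq 'I_d, continuous (foldr partial f s) /\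
    forall x i, derivable (foldr partial f s) x (delta_mx 0 i).

Definition diff_op (a : V -> 'M[R]_d) (b : V -> V) (f : V -> R) : V -> R :=
  fun x => \sum_(i < d) \sum_(k < d) a x i k * partial i (partial k f) x
           + \sum_(i < d) b x 0 i * partial i f x.

Definition uniformly_elliptic (D : set V) (a : V -> 'M[R]_d) : Prop :=
  exists2 c : R, 0 < c & forall x xi, D x ->
    c * inner xi xi <= \sum_(i < d) \sum_(k < d) a x i k * xi 0 i * xi 0 k.

Definition uniformly_bounded (D : set V) (b : V -> V) : Prop :=
  exists M : R, forall x, D x -> `|b x| <= M.

Definition hoelder_continuous (W : normedModType R) (D : set V) (g : V -> W)
    : Prop :=
  exists K theta : R, 0 < theta <= 1 /\
    forall x y, D x -> D y -> `|g x - g y| <= K * `|x - y| `^ theta.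
End Operator.

Section Process.
Variables (R : realType) (d : nat) (dO : measure_display)
  (Omega : measurableType dO).
Local Notation V := 'rV[R]_d.
(* [P x] is the law of the process started from [x]; it is only meaningful for
   [x] in the state space. [X t] is only meaningful for [0 <= t]. *)
Variables (P : R.-pker V ~> Omega) (X : R -> Omega -> V).

(* the law P_mu, with initial distribution mu *)
Definition prob (mu : probability V R) (F : set Omega) : R :=
  fine (\int[mu]_x P x F).

Definition hitting_time (D : set V) (w : Omega) : \bar R :=
  ereal_inf [set t%:E | t in [set t : R | (0 <= t) /\ D (X t w)]].

(* the event that the process has not entered D by time t *)
Definition alive (D : set V) (t : R) : set Omega :=
  [set w | (t%:E < hitting_time D w)%E].

(* P_mu(X_t \in A | t < hitting time of D) *)
Definition cond_law (D : set V) (mu : probability V R) (t : R) (A : set V)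
    : R :=
  prob mu (X t @^-1` A `&` alive D t) / prob mu (alive D t).

Definition natural_filtration (t : R) : set (set Omega) :=
  <<s [set F | exists s A,
         [/\ 0 <= s <= t, measurable A & F = X s @^-1` A]] >>.

Definition stopping_time (T : Omega -> \bar R) : Prop :=
  (forall w, (0 <= T w)%E) /\
  forall t, 0 <= t -> natural_filtration t [set w | (T w <= t%:E)%E].

(* G belongs, up to its part in {T = +oo}, to the sigma-algebra F_T *)
Definition stopped_event (T : Omega -> \bar R) (G : set Omega) : Prop :=
  forall t, 0 <= t ->
    natural_filtration t (G `&` [set w | (T w <= t%:E)%E]).

Definition strong_markov (S : set V) : Prop :=
  forall T G, stopping_time T -> stopped_event T G ->
  forall x t A, S x -> 0 <= t -> measurable A ->
    P x (G `&` [set w | ((T w < +oo)%E) /\ A (X (fine (T w) + t) w)]) =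
    (\int[P x]_(w in G `&` [set w | (T w < +oo)%E])
       P (X (fine (T w)) w) (X t @^-1` A))%E.

(* [g] is the image of [f] under the (weak) infinitesimal generator: the
   difference quotients of the semigroup converge boundedly and pointwise on
   the set D of non-absorbed states. Uniform convergence would be too much to
   ask near the absorbing boundary, where [g] need not vanish. *)
Definition in_generator (D : set V) (f g : V -> R) : Prop :=
  (forall x, D x ->
     (Rintegral (P x) setT (fun w => f (X t w)) - f x) / t @[t --> 0^'+]
       --> g x) /\
  exists M : R, forall x t, D x -> 0 < t ->
    `|(Rintegral (P x) setT (fun w => f (X t w)) - f x) / t| <= M.
End Process.

Section Diffusion.
Variables (R : realType) (d r : nat) (dO : measure_display)
  (Omega : measurableType dO).
Local Notation V := 'rV[R]_d.
Variables (v : 'I_r -> V) (a : V -> 'M[R]_d) (b : V -> V).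
Variables (P : R.-pker V ~> Omega) (X : R -> Omega -> V).

Let E := dom v.
Let bd := absorb v.

Record is_diffusion : Prop := {
  diff_coef_sym : forall x, (E `|` bd) x -> (a x)^T = a x;
  diff_coef_elliptic : uniformly_elliptic (E `|` bd) a;
  diff_coef_hoelder : hoelder_continuous (E `|` bd) a;
  drift_bounded : uniformly_bounded (E `|` bd) b;
  drift_hoelder : hoelder_continuous (E `|` bd) b;
  proc_measurable : forall t, 0 <= t -> measurable_fun setT (X t);
  proc_state : forall t w, 0 <= t -> (E `|` bd) (X t w);
  proc_continuous : forall w,
    {within [set t : R | 0 <= t], continuous (fun t => X t w)};
  proc_initial : forall x, (E `|` bd) x -> P x (X 0 @^-1` [set x]) = 1%E;
  proc_markov : strong_markov P X (E `|` bd);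
  proc_absorbed : forall t w, 0 <= t -> (hitting_time X bd w <= t%:E)%E ->
    bd (X t w);
  proc_generator : forall f, smooth f ->
    (forall x, bd x -> f x = 0) ->
    (forall x i, (E `|` bd) x -> x 0 i = 0 -> partial i f x = 0) ->
    in_generator P X E f (diff_op a b f)
}.

Definition is_qsd (alpha : probability V R) : Prop :=
  alpha E = 1%E /\
  forall t A, 0 <= t -> measurable A ->
    cond_law P X bd alpha t A = fine (alpha A).

(* [eta] is an eigenfunction of the generator for [ev], extended by 0 to the
   absorbing boundary, where it vanishes continuously *)
Definition dirichlet_eigenfunction (ev : R) (eta : V -> R) : Prop :=
  in_generator P X E eta (fun x => ev * eta x) /\
  forall x, bd x -> eta x = 0 /\ eta y @[y --> within E (nbhs x)] --> 0.
End Diffusion.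

(* Main.v *)
Require Import Defs.
From mathcomp Require Import all_boot all_order all_algebra.
From mathcomp Require Import all_classical all_reals all_analysis.
From mathcomp Require Import measurable_realfun ring lra.

Import Order.TTheory GRing.Theory Num.Theory.
Import numFieldNormedType.Exports.

Local Open Scope classical_set_scope.
Local Open Scope ring_scope.

(* Write S_t(x) = P_x(t < tau). The bound on eta is the convergence estimate
   for e^{lambda0 t} S_t together with S_t <= 1. If f <= K on a set D of full
   mass, then int_D f <= int_A f + K (1 - alpha(A)); with f = eta this gives the
   second bound, and with f = S_t and D the whole space it gives
   1 - P_{alpha|B}(t < tau) <= (1 - e^{-lambda0 t}) / alpha(B).
   For A inside E, the event X_t in A entails survival, so its probability is
   q p with q the conditional law of A and p the survival probability, and
   |q p - alpha(A)| <= |q - alpha(A)| p + alpha(A) (1 - p), where p is at most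
   e^{-lambda0 t} (sup eta + C e^{-gamma t}). *)

(** * Borel measurability of the domain and of the absorbing set *)

Section BorelVectors.
Context {R : realType}.

(** Borel sets of matrices are generated by the open ones, so a closed preimage is reached through
    its complement. *)
Lemma measurable_preimage_closed {m n} (f : 'M[R]_(m, n) -> R) {F : set R} :
  continuous f -> closed F -> measurable (f @^-1` F).
Proof.
move=> /continuous_closedP cf /cf cF.
rewrite -[X in measurable X]setCK; apply: measurableC.
by apply: sub_sigma_algebra; exact: closed_openC.
Qed.

Lemma measurable_coord_ge0 d (i : 'I_d) :
  measurable [set x : 'rV[R]_d | 0 <= x 0 i].
Proof.
exact: (measurable_preimage_closed _ (@coord_continuous R 1 d 0 i)
  (@closed_ge R 0)).
Qed.

Lemma continuous_inner d (y : 'rV[R]_d) : continuous (fun x => inner x y).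
Proof.
apply: continuous_big => [|i _ x]; first exact: add_continuous.
by apply: (@continuousM R); [exact: coord_continuous|exact: cst_continuous].
Qed.

Lemma measurable_inner_le1 d (y : 'rV[R]_d) : measurable [set x | inner x y <= 1].
Proof.
exact: (measurable_preimage_closed _ (continuous_inner _ y) (@closed_le R 1)).
Qed.

Lemma measurable_inner_lt1 d (y : 'rV[R]_d) : measurable [set x | inner x y < 1].
Proof.
have -> : [set x | inner x y < 1] = ~` [set x | 1 <= inner x y].
  by apply/seteqP; split => x /=; rewrite ltNge => /negP.
apply: measurableC.
exact: (measurable_preimage_closed _ (continuous_inner _ y) (@closed_ge R 1)).
Qed.

Lemma measurable_forall d (V := 'rV[R]_d) (I : finType) (F : I -> set V) :
  (forall i, measurable (F i)) -> measurable [set x | forall i, F i x].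
Proof.
move=> mF.
have -> : [set x | forall i, F i x] = \bigcap_i F i.
  by apply/seteqP; split => x /= Fx i; [move=> _|]; exact: Fx.
exact: fin_bigcap_measurable.
Qed.

Lemma measurable_dom d r (v : 'I_r -> 'rV[R]_d) : measurable (dom v).
Proof.
apply: measurableI; apply: measurable_forall => i.
- exact: measurable_coord_ge0.
- exact: measurable_inner_lt1.
Qed.

(** Once all inner products are at most 1, leaving the domain means that one of them equals 1. The
    difference form yields both measurability and disjointness from [dom v]. *)
Lemma absorbE d r (v : 'I_r -> 'rV[R]_d) : absorb v =
  ([set x : 'rV[R]_d | forall i, 0 <= x 0 i]
    `&` [set x | forall j, inner x (v j) <= 1]) `\` dom v.
Proof.
apply/seteqP; split => [x [x0 x1 [j xj]]|x [[/= x0 x1] xE]].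
  by split=> // -[_ /(_ j)]; rewrite xj ltxx.
split=> //; apply: contrapT => /forallNP xN; apply: xE; split=> // j.
by rewrite lt_neqAle x1 andbT; apply/eqP/xN.
Qed.

Lemma measurable_absorb d r (v : 'I_r -> 'rV[R]_d) : measurable (absorb v).
Proof.
rewrite absorbE; apply: measurableD; last exact: measurable_dom.
apply: measurableI; apply: measurable_forall => i.
- exact: measurable_coord_ge0.
- exact: measurable_inner_le1.
Qed.

Lemma dom_absorb_disj d r (v : 'I_r -> 'rV[R]_d) x : dom v x -> ~ absorb v x.
Proof. by rewrite absorbE => xE [_]. Qed.

End BorelVectors.

Lemma normr_le_tv_norm d (T : measurableType d) (R : realType) (nu : set T -> R)
    (A : set T) :
  measurable A -> (`|nu A|%:E <= tv_norm nu)%E.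
Proof.
move=> mA; apply: ereal_sup_ubound.
(* A family with the single summed member [A], padded with empty sets. *)
exists (1%N, fun i => if i is 0%N then A else set0) => /=.
  split=> [[|i]|] //; apply/trivIsetP => -[|i] [|j] // _ _ _.
  - by rewrite setI0.
  - by rewrite set0I.
  - by rewrite set0I.
by rewrite big_ord1.
Qed.

(** * Conditioning a probability measure on a set of positive mass *)

Section Conditioning.
Local Open Scope ereal_scope.
Context d (T : measurableType d) (R : realType).
Variables (mu : probability T R) (B : set T) (mB : measurable B).
Hypothesis B0 : 0 < mu B.

Lemma mnormalize_mrestrE U : mnormalize (mrestr mu mB) mu U =
  mu (U `&` B) * ((fine (mu B))^-1)%:E.
Proof.
(* [mnormalize] falls back on its last argument when the mass is 0 or infinite; both cases are
   excluded here. *)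
rewrite /mnormalize /= /mrestr setTI gt_eqF//= lt_eqF//.
by rewrite ltey_eq fin_num_measure.
Qed.

(** The conditioned measure does not charge the complement of [B], and inside [B] it is [mu] scaled
    by 1 / mu(B). *)
Lemma ge0_integral_mnormalize_mrestr (f : T -> \bar R) :
  measurable_fun setT f -> (forall x, 0 <= f x) ->
  \int[mnormalize (mrestr mu mB) mu]_x f x =
  ((fine (mu B))^-1)%:E * \int[mu]_(x in B) f x.
Proof.
move=> mf f0; have k0 : (0 <= (fine (mu B))^-1)%R by rewrite invr_ge0 fine_ge0.
rewrite -(setvU B) ge0_integral_setU//; last 3 first.
- exact: measurableC.
- by rewrite setvU.
- by rewrite disj_set2E setICl.
rewrite null_set_integral ?add0e; last 3 first.
- exact: measurableC.
- exact: measurable_funTS.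
- by rewrite [LHS]mnormalize_mrestrE setICl measure0 mul0e.
rewrite -[RHS](ge0_integral_mscale _ mB (NngNum k0))//; last exact: measurable_funTS.
apply: eq_measure_integral => A mA AB.
by rewrite [LHS]mnormalize_mrestrE setIidl// muleC.
Qed.

End Conditioning.

(** * Probabilities of events under a general initial law *)

Section KernelProb.
Context {R : realType} {d : nat} {dO : measure_display}
  {Omega : measurableType dO} (P : R.-pker 'rV[R]_d ~> Omega).
Implicit Types (mu : probability 'rV[R]_d R) (F : set Omega).

Lemma pker_le1 x F : measurable F -> (P x F <= 1)%E.
Proof. by move=> mF; rewrite -(prob_kernel (s := P) x) le_measure ?inE. Qed.

Lemma pker_fin_num x F : measurable F -> P x F \is a fin_num.
Proof.
by move=> mF; rewrite ge0_fin_numE// (le_lt_trans (pker_le1 x _ mF)) ?ltry.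
Qed.

Lemma fine_pker_le1 x F : measurable F -> fine (P x F) <= 1.
Proof. by move=> mF; rewrite -lee_fin fineK ?pker_fin_num ?pker_le1. Qed.

Lemma measurable_fine_pker F : measurable F ->
  measurable_fun setT (fun x => fine (P x F)).
Proof. by move=> mF; apply: measurableT_comp => //; exact: measurable_kernel. Qed.

Lemma integrable_fine_pker mu D F : measurable D -> measurable F ->
  mu.-integrable D (fun x => (fine (P x F))%:E).
Proof.
move=> mD mF; apply: (measurable_bounded_integrable (f := fun x => fine (P x F))) => //.
- by rewrite (le_lt_trans (probability_le1 mu mD)) ?ltry.
- by apply: measurable_funTS; exact: measurable_fine_pker.
- exists 1; split=> // M M1 x _ /=.
  by rewrite ger0_norm ?fine_ge0// (le_trans (fine_pker_le1 x _ mF))// ltW.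
Qed.

Lemma prob_Rintegral mu F : measurable F ->
  prob P mu F = \int[mu]_x fine (P x F).
Proof.
move=> mF; rewrite /prob /Rintegral; congr fine; apply: eq_integral => x _.
by rewrite fineK// pker_fin_num.
Qed.

Lemma prob_ge0 mu F : 0 <= prob P mu F.
Proof. by rewrite /prob fine_ge0// integral_ge0. Qed.

Lemma le_prob mu F G : measurable F -> measurable G -> F `<=` G ->
  prob P mu F <= prob P mu G.
Proof.
move=> mF mG FG; rewrite !prob_Rintegral//; apply: le_Rintegral => //.
- exact: integrable_fine_pker.
- exact: integrable_fine_pker.
by move=> x _; rewrite fine_le ?pker_fin_num// le_measure ?inE.
Qed.

Lemma prob_mnormalize_mrestr mu (B : set 'rV[R]_d) (mB : measurable B) F :
  (0 < mu B)%E -> measurable F ->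
  prob P (mnormalize (mrestr mu mB) mu) F =
  (fine (mu B))^-1 * \int[mu]_(x in B) fine (P x F).
Proof.
move=> B0 mF; rewrite /prob ge0_integral_mnormalize_mrestr//; last exact: measurable_kernel.
rewrite (eq_integral (fun x => (fine (P x F))%:E)); last first.
  by move=> x _; rewrite fineK// pker_fin_num.
rewrite fineM//; apply: integrable_fin_num => //; exact: integrable_fine_pker.
Qed.

End KernelProb.

Lemma fine_probability_setD d (T : measurableType d) (R : realType)
    (mu : probability T R) (D A : set T) : measurable D -> measurable A ->
  A `<=` D -> mu D = 1%E -> fine (mu (D `\` A)) = 1 - fine (mu A).
Proof.
move=> mD mA AD D1; rewrite measureD//; last by rewrite ltey_eq fin_num_measure.
by rewrite setIidr// [X in fine (X - _)]D1 fineB// fin_num_measure.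
Qed.

(** * Survival events and the conditional law *)

Section Absorption.
Context {R : realType} {d r : nat} {dO : measure_display}
  {Omega : measurableType dO} {v : 'I_r -> 'rV[R]_d}
  {a : 'rV[R]_d -> 'M[R]_d} {b : 'rV[R]_d -> 'rV[R]_d}
  {P : R.-pker 'rV[R]_d ~> Omega} {X : R -> Omega -> 'rV[R]_d}.
Hypothesis hX : is_diffusion v a b P X.

(* Absorbed paths stay in the absorbing set, so a single time decides survival. *)
Lemma aliveE t : 0 <= t -> alive X (absorb v) t = X t @^-1` (~` absorb v).
Proof.
move=> t0; apply/seteqP; split => w /=.
  move=> tH Xt; move: tH; rewrite /alive /= ltNge => /negP; apply.
  by apply: ereal_inf_lbound; exists t.
move=> Xt; rewrite /alive /= ltNge; apply/negP => Ht; apply: Xt.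
exact: (proc_absorbed hX).
Qed.

Lemma measurable_preimage_X t A : 0 <= t -> measurable A ->
  measurable (X t @^-1` A).
Proof.
move=> t0 mA; rewrite -[X in measurable X]setTI.
exact: (proc_measurable hX t0 measurableT).
Qed.

(** The hitting time is an infimum over uncountably many times; looking only at time [t] turns
    survival into the preimage of a Borel set. *)
Lemma measurable_alive t : 0 <= t -> measurable (alive X (absorb v) t).
Proof.
move=> t0; rewrite aliveE//; apply: measurable_preimage_X => //.
by apply: measurableC; exact: measurable_absorb.
Qed.

Lemma preimage_sub_alive t A : 0 <= t -> A `<=` dom v ->
  X t @^-1` A `<=` alive X (absorb v) t.
Proof. by move=> t0 AE w /= /AE XE; rewrite aliveE//; exact: dom_absorb_disj. Qed.

(** Being in [A] at time [t] already entails survival, so the intersection in [cond_law] is the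
    event itself. *)
Lemma prob_cond_law mu t A : 0 <= t -> measurable A -> A `<=` dom v ->
  prob P mu (X t @^-1` A) =
  cond_law P X (absorb v) mu t A * prob P mu (alive X (absorb v) t).
Proof.
move=> t0 mA AE; rewrite /cond_law setIidl; last exact: preimage_sub_alive.
(* at survival probability 0, the division in [cond_law] gives 0 *)
have [p0|p0] := eqVneq (prob P mu (alive X (absorb v) t)) 0; last by rewrite divfK.
rewrite p0 mulr0; apply/eqP; rewrite eq_le prob_ge0 andbT -p0.
apply: le_prob; [exact: measurable_preimage_X|exact: measurable_alive|].
exact: preimage_sub_alive.
Qed.

End Absorption.

(** Sampling at integer times reduces the claim to a sequential limit. It serves to make [eta],
    known as a limit of survival functions, measurable. *)
Lemma measurable_fun_cvg_pinfty d (T : measurableType d) (R : realType)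
    (D : set T) (h : R -> T -> R) (f : T -> R) :
  (forall t, 0 <= t -> measurable_fun D (h t)) ->
  (forall x, D x -> h t x @[t --> +oo] --> f x) -> measurable_fun D f.
Proof.
move=> mh hf; apply: (measurable_fun_cvg (h := fun n => h n%:R)) => [n|x Dx].
  exact: mh.
apply: (cvg_comp (fun n : nat => n%:R : R) (h ^~ x) _ (hf x Dx)); exact: cvgr_idn.
Qed.

(** The integral splits over [A] and its complement in [D], where [f] is at most [K] and the mass is
    1 - mu(A). *)
Lemma Rintegral_le_subset d (T : measurableType d) (R : realType)
    (mu : probability T R) (D A : set T) (f : T -> R) (K : R) :
  measurable D -> measurable A -> A `<=` D -> mu D = 1%E ->
  mu.-integrable D (EFin \o f) -> (forall x, D x -> f x <= K) ->
  \int[mu]_(x in D) f x <= \int[mu]_(x in A) f x + K * (1 - fine (mu A)).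
Proof.
move=> mD mA AD D1 intf fK.
have mDA : measurable (D `\` A) by exact: measurableD.
have intDA : mu.-integrable (D `\` A) (EFin \o f).
  by apply: (integrableS mD) => //; exact: subDsetl.
rewrite -[in leLHS](setDUK AD) Rintegral_setU ?setDUK//; last first.
  by rewrite disj_set2E setDIK.
rewrite lerD2l -(fine_probability_setD _ _ _ mu D A)// -Rintegral_cst//.
apply: le_Rintegral => // [|x [Dx _]]; last exact: fK.
apply: (measurable_bounded_integrable (f := cst K)) => //.
  by rewrite (le_lt_trans (probability_le1 mu mDA)) ?ltry.
by exists `|K|; split=> // M KM x _; exact: ltW.
Qed.

(** * Bounds on probabilities from a conditioned initial law *)

Section ConditionedProb.
Context {R : realType} {d : nat} {dO : measure_display}
  {Omega : measurableType dO} (P : R.-pker 'rV[R]_d ~> Omega)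
  (mu : probability 'rV[R]_d R) (B : set 'rV[R]_d) (mB : measurable B)
  (F : set Omega) (mF : measurable F).
Hypothesis B0 : (0 < mu B)%E.
Let muB := mnormalize (mrestr mu mB) mu.

Let fineB0 : 0 < fine (mu B).
Proof. by rewrite fine_gt0// B0 ltey_eq fin_num_measure. Qed.

Lemma prob_conditioned_le K : (forall x, B x -> fine (P x F) <= K) ->
  prob P muB F <= K.
Proof.
move=> FK; rewrite prob_mnormalize_mrestr// mulrC ler_pdivrMr//.
rewrite -Rintegral_cst//; apply: le_Rintegral => //.
- exact: integrable_fine_pker.
apply: (measurable_bounded_integrable (f := cst K)) => //.
  by rewrite (le_lt_trans (probability_le1 mu mB)) ?ltry.
by exists `|K|; split=> // M KM x _; exact: ltW.
Qed.

Lemma prob_conditionedC_le :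
  1 - prob P muB F <= (1 - prob P mu F) / fine (mu B).
Proof.
rewrite ler_pdivlMr// prob_mnormalize_mrestr// mulrBl mul1r.
rewrite mulrAC mulVf ?gt_eqF// mul1r (prob_Rintegral _ mu)//.
(* Taking the bound 1 on the whole space gives P_mu(F) <= int_B P_x(F) + 1 - mu(B), which is the
   claim multiplied by mu(B). *)
have := Rintegral_le_subset _ _ _ mu setT B (fun x => fine (P x F)) 1.
move=> /(_ measurableT mB (@subsetT _ _) (probability_setT _)).
move=> /(_ (integrable_fine_pker _ _ _ _ measurableT mF)).
move=> /(_ (fun x _ => fine_pker_le1 _ x _ mF)); lra.
Qed.

End ConditionedProb.

(* The instance of interest: [m] is alpha(A), [q] and [p] are the conditional
   law of A and the survival probability at time t under alpha restricted to B,
   [eps] is C e^{-gamma t}, [L] is e^{-lambda0 t} and [S] is the sup of eta. *)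
Lemma absorbed_law_dist_le (R : realType) (m p q eps L S beta : R) :
  0 <= m -> 0 < beta -> 0 <= p <= 1 -> 0 <= eps -> 0 <= L ->
  `|q - m| <= eps -> p <= L * (S + eps) -> 1 - p <= (1 - L) / beta ->
  `|q * p - m| <= m / beta * (1 - L + L * eps)
                  + L * eps * (S + 2 * m + eps).
Proof.
move=> m0 b0 /andP[p0 p1] e0 L0 qm pS pL.
have -> : q * p - m = (q - m) * p - m * (1 - p) by ring.
rewrite (le_trans (ler_normB _ _))// normrM (ger0_norm p0).
rewrite (@ger0_norm _ (m * _)) ?mulr_ge0 ?subr_ge0//.
have qmp : `|q - m| * p <= eps * (L * (S + eps)) by rewrite ler_pM.
have mp : m * (1 - p) <= m * ((1 - L) / beta) by rewrite ler_wpM2l.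
(* [s1] and [s2] are the nonnegative surplus of the stated bound over the sum of [qmp] and [mp]. *)
have s1 : 0 <= m / beta * (L * eps) by rewrite !mulr_ge0 ?invr_ge0// ltW.
have s2 : 0 <= L * eps * (2 * m) by rewrite !mulr_ge0.
have -> : m / beta * (1 - L + L * eps) = m * ((1 - L) / beta) + m / beta * (L * eps).
  by ring.
have -> : L * eps * (S + 2 * m + eps) = eps * (L * (S + eps)) + L * eps * (2 * m).
  by ring.
lra.
Qed.

Theorem proposition4p4 (R : realType) (d r : nat)
  (hd : (1 <= d)%N) (hr : (1 <= r)%N)
  (v : 'I_r -> 'rV[R]_d)
  (hv : forall j, (forall i, 0 <= v j 0 i) /\ v j <> 0)
  (hE : bounded_set (dom v))
  (a : 'rV[R]_d -> 'M[R]_d) (b : 'rV[R]_d -> 'rV[R]_d)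
  (dO : measure_display) (Omega : measurableType dO)
  (P : R.-pker 'rV[R]_d ~> Omega) (X : R -> Omega -> 'rV[R]_d)
  (hX : is_diffusion v a b P X)
  (alpha : probability 'rV[R]_d R)
  (halpha : is_qsd v P X alpha)
  (halpha_unique : forall beta : probability 'rV[R]_d R, is_qsd v P X beta ->
     forall A, measurable A -> beta A = alpha A)
  (lambda0 : R) (hlambda0 : 0 < lambda0)
  (hrate : forall t, 0 <= t ->
     prob P alpha (alive X (absorb v) t) = expR (- lambda0 * t))
  (eta : 'rV[R]_d -> R)
  (heta_lim : forall x, dom v x ->
     expR (lambda0 * t) * fine (P x (alive X (absorb v) t)) @[t --> +oo]
       --> eta x)
  (heta_pos : forall x, dom v x -> 0 < eta x)
  (heta_bounded : exists M, forall x, dom v x -> eta x <= M)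
  (heta_eigen : dirichlet_eigenfunction v P X (- lambda0) eta)
  (heta_int : \int[alpha]_(x in dom v) eta x = 1)
  (C gamma : R) (hC : 0 < C) (hgamma : 0 < gamma)
  (hcv_law : forall (t : R) (mu : probability 'rV[R]_d R), 0 <= t ->
     mu (dom v) = 1%E ->
     (tv_norm (fun A => (cond_law P X (absorb v) mu t A - fine (alpha A))%R)
       <= (C * expR (- gamma * t))%:E)%E)
  (hcv_eta : forall (t : R) x, 0 <= t -> dom v x ->
     `|expR (lambda0 * t) * fine (P x (alive X (absorb v) t)) - eta x|
       <= C * expR (- gamma * t)) :
  [/\ forall t x, 0 <= t -> dom v x ->
        eta x <= expR (lambda0 * t) + C * expR (- gamma * t),
      forall t A, 0 <= t -> measurable A -> A `<=` dom v -> (0 < alpha A)%E ->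
        (fine (alpha A))^-1 * \int[alpha]_(x in A) eta x >=
        expR (lambda0 * t) + C * expR (- gamma * t)
        - (expR (lambda0 * t) - 1 + C * expR (- gamma * t)) / fine (alpha A)
    & forall (B : set 'rV[R]_d) (mB : measurable B), B `<=` dom v ->
        (0 < alpha B)%E ->
        forall t A, 0 <= t -> measurable A -> A `<=` dom v ->
        `|prob P (mnormalize (mrestr alpha mB) alpha) (X t @^-1` A)
          - fine (alpha A)| <=
        fine (alpha A) / fine (alpha B)
          * (1 - expR (- lambda0 * t) + C * expR (- (lambda0 + gamma) * t))
        + C * expR (- (lambda0 + gamma) * t)
          * (sup (eta @` dom v) + 2 * fine (alpha A) + C * expR (- gamma * t))].
Proof.
have alive_m t : 0 <= t -> measurable (alive X (absorb v) t).
  exact: (measurable_alive hX).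
have mE := measurable_dom _ _ v.
have [aE _] := halpha.
have eta_le t x : 0 <= t -> dom v x ->
    eta x <= expR (lambda0 * t) + C * expR (- gamma * t).
  move=> t0 Ex; have := hcv_eta t x t0 Ex; rewrite distrC => /ler_normlW.
  have := fine_pker_le1 P x _ (alive_m _ t0).
  rewrite -(ler_pM2l (expR_gt0 (lambda0 * t))) mulr1; lra.
split=> [//|t A t0 mA AE A0|B mB BE B0 t A t0 mA AE].
- set K := expR _ + _.
  have m0 : 0 < fine (alpha A) by rewrite fine_gt0// A0 ltey_eq fin_num_measure.
  have meta : measurable_fun (dom v) eta.
    apply: (measurable_fun_cvg_pinfty _ _ _ _
      (fun t x => expR (lambda0 * t) * fine (P x (alive X (absorb v) t)))) => //.
    move=> s s0; apply: measurable_funTS; apply: measurable_funM => //.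
    by apply: measurable_fine_pker; exact: alive_m.
  have ieta : alpha.-integrable (dom v) (EFin \o eta).
    apply: measurable_bounded_integrable => //; first by rewrite [X in (X < _)%E]aE ltry.
    have [M etaM] := heta_bounded.
    exists M; split=> [|N MN x Ex /=]; first exact: num_real.
    by rewrite gtr0_norm ?heta_pos// (le_trans (etaM _ Ex))// ltW.
  (* Since [eta] has integral 1, this reads 1 <= int_A eta + K (1 - alpha(A)). Divided by alpha(A),
     it becomes the claimed lower bound K - (K - 1) / alpha(A). *)
  have := Rintegral_le_subset _ _ _ alpha _ _ _ K mE mA AE aE ieta (fun x => eta_le t x t0).
  rewrite heta_int -(ler_pM2l (x := (fine (alpha A))^-1)) ?invr_gt0// mulr1 mulrDr.
  have -> : (fine (alpha A))^-1 * (K * (1 - fine (alpha A))) =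
      K / fine (alpha A) - K by field; rewrite gt_eqF.
  have -> : (expR (lambda0 * t) - 1 + C * expR (- gamma * t)) / fine (alpha A) =
      K / fine (alpha A) - (fine (alpha A))^-1 by rewrite /K; field; rewrite gt_eqF.
  lra.
- have b0 : 0 < fine (alpha B) by rewrite fine_gt0// B0 ltey_eq fin_num_measure.
  set muB := mnormalize _ _.
  (* The conditioned law lives on the domain, so the convergence estimate [hcv_law] applies to
     it. *)
  have muBE : muB (dom v) = 1%E.
    rewrite [LHS]mnormalize_mrestrE// setIidr//.
    by rewrite -[alpha B]fineK ?fin_num_measure// -EFinM divff// gt_eqF.
  have p_le1 : prob P muB (alive X (absorb v) t) <= 1.
    by apply: prob_conditioned_le => [||x _]; [exact: alive_m| |by apply: fine_pker_le1; exact: alive_m].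
  (* Splitting the exponential puts the goal in the form L * eps, with L = e^{-lambda0 t} and eps =
     C e^{-gamma t}. *)
  have expL : expR (- (lambda0 + gamma) * t) = expR (- lambda0 * t) * expR (- gamma * t).
    by rewrite -expRD; congr expR; ring.
  rewrite expL mulrCA.
  rewrite (prob_cond_law hX)//; apply: absorbed_law_dist_le.
  + exact: fine_ge0.
  + exact: b0.
  + by rewrite prob_ge0 p_le1.
  + by rewrite mulr_ge0 ?expR_ge0// ltW.
  + exact: expR_ge0.
  + rewrite -lee_fin; apply: le_trans (hcv_law t muB t0 muBE).
    exact: (normr_le_tv_norm _ _ _ (fun A => cond_law P X (absorb v) muB t A - fine (alpha A))).
  + apply: prob_conditioned_le => [||x Bx]; [exact: alive_m|exact: B0|].
    have Ex := BE _ Bx.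
    (* Writing 1 as L e^{lambda0 t} lets L cancel; what remains is e^{lambda0 t} S_t(x) <= sup eta +
       eps, from eta(x) <= sup eta and [hcv_eta]. *)
    have LL : expR (- lambda0 * t) * expR (lambda0 * t) = 1.
      by rewrite -expRD mulNr addNr expR0.
    rewrite -[leLHS]mul1r -LL -mulrA ler_pM2l ?expR_gt0//.
    have := hcv_eta t x t0 Ex => /ler_normlW.
    have : eta x <= sup (eta @` dom v).
      apply: ub_le_sup; last by exists x.
      by have [M etaM] := heta_bounded; exists M => _ [y Ey <-]; exact: etaM.
    lra.
  (* Here e^{-lambda0 t} is read back as the survival probability under [alpha]. *)
  + rewrite -hrate//; apply: prob_conditionedC_le => //; exact: alive_m.
Qed.
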